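(* Let $n\geqslant -1$ be an integer. The poset $(\mathbb G_n,\geqslant)$ is a lattice in which, for $G,H\in\mathbb G_n\setminus\{\infty,\overline\infty\}$, the join and meet are given by $$G\vee H=\{\lfloor G\rfloor_n\cup\lfloor H\rfloor_n\ \|\ (\lceil G\rceil_n\cap\lceil H\rceil_n)\cup\{\infty\}\},$$ $$G\wedge H=\{(\lfloor G\rfloor_n\cap\lfloor H\rfloor_n)\cup\{\overline\infty\}\ \|\ \lceil G\rceil_n\cup\lceil H\rceil_n\}.$$
   Context: Affine games are defined recursively. There are two games without options, denoted $\infty$ and $\overline{\infty}$ (terminating games), of formal birthday $-1$. Every other affine game is a form $G=\{G^{\mathcal L}\mid G^{\mathcal R}\}$, where $G^{\mathcal L}$ (Left options) and $G^{\mathcal R}$ (Right options) are non-empty finite sets of previously constructed affine games; its formal birthday is $1$ plus the maximum formal birthday of its options. Let $\mathbb A$ be the set of all affine games. (The symbol $\|$ in a game form separates Left options from Right options, exactly like $\mid$.) Disjunctive sum: $G+H$ is undefined if one of $G,H$ is the form $\infty$ and the other is $\overline\infty$; it is $\infty$ if one is $\infty$ and the other is not $\overline\infty$; it is $\overline\infty$ if one is $\overline\infty$ and the other is not $\infty$; otherwise $G+H=\{G^{\mathcal L}+H,\,G+H^{\mathcal L}\mid G^{\mathcal R}+H,\,G+H^{\mathcal R}\}$. Outcomes: $o^L(G)=\mathbf L$ if $G=\infty$ or some $G^L\in G^{\mathcal L}$ has $o^R(G^L)=\mathbf L$, and $o^L(G)=\mathbf R$ otherwise; $o^R(G)=\mathbf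 R$ if $G=\overline\infty$ or some $G^R\in G^{\mathcal R}$ has $o^L(G^R)=\mathbf R$, and $o^R(G)=\mathbf L$ otherwise. With $\mathbf L>\mathbf R$, $o(G)=(o^L(G),o^R(G))$ is ordered componentwise. Order and equality: $G\geqslant H$ iff $o(G+X)\geqslant o(H+X)$ for all $X\in\mathbb A\setminus\{\infty,\overline\infty\}$; $G=H$ iff $o(G+X)=o(H+X)$ for all such $X$ (an equivalence relation on forms). The birthday of $G$ is the smallest formal birthday among forms $G'$ with $G'=G$. $\mathbb G_n$ is the (finite) set of equivalence classes, under equality of games, of affine games of birthday at most $n$, partially ordered by $\geqslant$; elements are handled through representatives, and options are considered up to equality. For $G\in\mathbb G_n$: $\lfloor G\rfloor_n$ is the set of all $W$ for which there is some form $\{G^{\mathcal L}\mid G^{\mathcal R}\}$ equal to $G$ such that all games in $G^{\mathcal L}$ and $G^{\mathcal R}$ have birthday less than $n$ and $W\in G^{\mathcal L}$; $\lceil G\rceil_n$ is the set of all $W$ for which there is some form $\{G^{\mathcal L}\mid G^{\mathcal R}\}$ equal to $G$ such that all games in $G^{\mathcal L}$ and $G^{\mathcal R}$ have birthday less than $n$ and $W\in G^{\mathcal R}$. (These are sets of equivalence classes, hence finite.) *)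

(* Defs.v *)
From HB Require Import structures.
From mathcomp Require Import all_boot all_order all_algebra.
From mathcomp Require Import boolp classical_sets.

Set Implicit Arguments.
Unset Strict Implicit.
Unset Printing Implicit Defensive.

Import Order.TTheory GRing.Theory Num.Theory.

Local Open Scope classical_set_scope.
Local Open Scope ring_scope.
Local Open Scope quotient_scope.

(* Forms.  [Inf] and [Minf] are the games oo and overline{oo}.
   [Game l ls r rs] is the form { l, ls | r, rs }: keeping the first Left and
   the first Right option apart makes both sets of options non-empty.  Finite
   sets are represented by lists; no notion below depends on the order or the
   multiplicity of the options. *)
Inductive form : Type :=
  | Inf
  | Minf
  | Game of form & seq form & form & seq form.

HB.instance Definition _ := gen_eqMixin form.
HB.instance Definition _ := gen_choiceMixin form.

Definition left_options (G : form) : seq form :=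
  if G is Game l ls _ _ then l :: ls else [::].

Definition right_options (G : form) : seq form :=
  if G is Game _ _ r rs then r :: rs else [::].

Definition terminating (G : form) : bool :=
  if G is Game _ _ _ _ then false else true.

Fixpoint formal_birthday (G : form) : int :=
  match G with
  | Inf | Minf => - 1
  | Game l ls r rs =>
      1 + Num.max
            (foldr (fun x => Num.max (formal_birthday x))
                   (formal_birthday l) ls)
            (foldr (fun x => Num.max (formal_birthday x))
                   (formal_birthday r) rs)
  end.

(* The sums [Inf + Minf] and [Minf + Inf] are undefined: the values given here
   are junk.  They are never used by the order, where the second summand is not
   terminating, so that in every recursive call at least one summand is not
   terminating. *)
Fixpoint add (G : form) : form -> form :=
  fix add_G (H : form) : form :=
    match G, H with
    | Inf, _ => Inf
    | Minf, _ => Minf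
    | _, Inf => Inf
    | _, Minf => Minf
    | Game l ls r rs, Game l' ls' r' rs' =>
        Game (add l H) ([seq add x H | x <- ls] ++ add_G l' :: map add_G ls')
             (add r H) ([seq add x H | x <- rs] ++ add_G r' :: map add_G rs')
    end.

(* Outcomes are booleans, [true] standing for L and [false] for R, so that
   L > R is the order of [bool]. *)
Fixpoint oL (G : form) : bool :=
  match G with
  | Inf => true
  | Minf => false
  | Game l ls _ _ => oR l || has oR ls
  end
with oR (G : form) : bool :=
  match G with
  | Inf => true
  | Minf => false
  | Game _ _ r rs => ~~ (~~ oL r || has (fun x => ~~ oL x) rs)
  end.

(* [bool *p bool] carries the componentwise order. *)
Definition outcome (G : form) : bool *p bool := (oL G, oR G).

Definition geg (G H : form) : Prop :=
  forall X, ~~ terminating X -> (outcome (add H X) <= outcome (add G X))%O.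

Definition eqg (G H : form) : Prop :=
  forall X, ~~ terminating X -> outcome (add G X) = outcome (add H X).

Definition eqgb : rel form := fun G H => `[< eqg G H >].

Lemma eqgb_refl : reflexive eqgb.
Proof. by move=> G; apply/asboolP. Qed.

Lemma eqgb_sym : symmetric eqgb.
Proof.
by move=> G H; apply/asboolP/asboolP => GH X nX; rewrite GH.
Qed.

Lemma eqgb_trans : transitive eqgb.
Proof.
move=> H G K /asboolP GH /asboolP HK; apply/asboolP => X nX.
by rewrite GH // HK.
Qed.

Canonical eqgb_equiv := EquivRel eqgb eqgb_refl eqgb_sym eqgb_trans.

Definition game : Type := {eq_quot eqgb_equiv}.
HB.instance Definition _ := Choice.on game.
HB.instance Definition _ := EqQuotient.on game.

Definition cls (G : form) : game := \pi_game G.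

Lemma clsP (G H : form) : cls G = cls H <-> eqg G H.
Proof.
by rewrite /cls; split=> [/eqquotP/asboolP|GH] //; apply/eqquotP/asboolP.
Qed.

Definition infty : game := cls Inf.
Definition minfty : game := cls Minf.

Definition leg (x y : game) : bool := `[< geg (repr y) (repr x) >].

Lemma leg_refl : reflexive leg.
Proof. by move=> x; apply/asboolP => X _. Qed.

Lemma leg_anti : antisymmetric leg.
Proof.
move=> x y /andP[/asboolP xy /asboolP yx].
rewrite -[x]reprK -[y]reprK; apply/clsP => X nX.
by apply/le_anti; rewrite xy // yx.
Qed.

Lemma leg_trans : transitive leg.
Proof.
move=> y x z /asboolP xy /asboolP yz; apply/asboolP => X nX.
by apply: le_trans (xy X nX) (yz X nX).
Qed.

Fact game_display : Order.disp_t. Proof. exact: Order.Disp tt tt. Qed.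

HB.instance Definition _ :=
  Order.Le_isPOrder.Build game_display game leg_refl leg_anti leg_trans.

Lemma le_cls (G H : form) : (cls H <= cls G)%O <-> geg G H.
Proof.
have rK K : eqg (repr (cls K)) K by apply/clsP; rewrite /cls reprK.
split=> [/asboolP GH X nX|GH]; first by rewrite -(rK G) // -(rK H) // GH.
by apply/asboolP => X nX; rewrite (rK G) // (rK H) // GH.
Qed.

Lemma formal_birthday_ge (G : form) : - 1 <= formal_birthday G.
Proof.
have H : forall s i, - 1 <= i ->
    - 1 <= foldr (fun x => Num.max (formal_birthday x)) i s.
  by elim=> //= x s IHs i i_ge; rewrite le_max IHs ?orbT.
move: G; fix IH 1 => -[||l ls r rs] //=.
by rewrite (le_trans (H ls _ (IH l)))// ler_wpDl// le_max lexx.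
Qed.

Lemma birthday_exists (x : game) :
  exists m : nat, `[< exists2 G, cls G = x & formal_birthday G = m%:Z - 1 >].
Proof.
have := formal_birthday_ge (repr x); rewrite lerNl -subr_ge0 opprK addrC.
case E : (formal_birthday (repr x) + 1) => [m|//] _.
exists m; apply/asboolP; exists (repr x); first exact: reprK.
by rewrite -E addrK.
Qed.

(* Formal birthdays start at -1, hence the shift by one. *)
Definition birthday (x : game) : int := (ex_minn (birthday_exists x))%:Z - 1.

Lemma birthdayP (x : game) :
  (exists2 G, cls G = x & formal_birthday G = birthday x) /\
  (forall G, cls G = x -> birthday x <= formal_birthday G).
Proof.
rewrite /birthday; case: ex_minnP => m /asboolP xm m_min; split=> // G Gx.
have := formal_birthday_ge G; rewrite lerNl -subr_ge0 opprK addrC.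
case E : (formal_birthday G + 1) => [k|//] _.
rewrite lerBlDr E lez_nat; apply/m_min/asboolP; exists G => //.
by rewrite -E addrK.
Qed.

(* The poset of the games of birthday at most [n]. *)
Definition games (n : int) : Type := {x : game | birthday x <= n}.
HB.instance Definition _ n := SubChoice.on (games n).
HB.instance Definition _ n :=
  [SubChoice_isSubPOrder of games n by <: with game_display].

Definition options_before (n : int) (G : form) : Prop :=
  forall W, W \in left_options G ++ right_options G -> birthday (cls W) < n.

Definition left_set (G : form) : set game :=
  [set cls W | W in [set` left_options G]].

Definition right_set (G : form) : set game :=
  [set cls W | W in [set` right_options G]].

Definition lfloor (n : int) (x : game) : set game :=
  [set w | exists G, [/\ ~~ terminating G, cls G = x, options_before n G
                       & left_set G w]].

Definition lceil (n : int) (x : game) : set game :=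
  [set w | exists G, [/\ ~~ terminating G, cls G = x, options_before n G
                       & right_set G w]].

(* [x] is the game { A | B }, for sets of games [A] and [B]: such a form exists
   (so [A] and [B] are finite and non-empty) and its class is [x] whatever
   representatives of the options are chosen. *)
Definition is_game_of (A B : set game) (x : game) : Prop :=
  let form_of G := [/\ ~~ terminating G, left_set G = A & right_set G = B] in
  (exists G, form_of G) /\ (forall G, form_of G -> cls G = x).

(* Main.v *)
(* The idea is an intrinsic description of the two sets: for G not terminating,
   W lies in floor(G)_n iff W has birthday < n and, for every X, a Left win
   moving second on W + X gives a Left win moving first on G + X; indeed such a
   W can be added to the Left options of any form of G without changing its
   class.  Dually for ceil(G)_n.  Hence G <= H makes floor(G)_n grow and
   ceil(G)_n shrink, and conversely G <= H as soon as every Left option W of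
   some form of G has the above property for H, and every Right option of some
   form of H has the dual property for G.  This makes the two displayed forms
   the least upper and greatest lower bounds; the options oo on the right and
   overline{oo} on the left are never useful moves and only keep the sets of
   options non-empty. *)
From Pilot Require Import Defs.
From HB Require Import structures.
From mathcomp Require Import all_boot all_order all_algebra.
From mathcomp Require Import boolp classical_sets.
From mathcomp Require Import zify.
Import Pilot.Defs.

Set Implicit Arguments.
Unset Strict Implicit.

Import Order.TTheory GRing.Theory Num.Theory.

Local Open Scope classical_set_scope.
Local Open Scope ring_scope.

(** * Sums and outcomes, one move at a time *)

Lemma add_terminatingl T X :
  terminating T -> ~~ terminating X -> add T X = T.
Proof. by case: T => // _; case: X. Qed.

Lemma add_terminatingr G T :
  ~~ terminating G -> terminating T -> add G T = T.
Proof. by case: G => // l ls r rs _; case: T. Qed.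

Lemma oL_add G X : ~~ terminating G -> ~~ terminating X ->
  oL (add G X) = has (fun W => oR (add W X)) (left_options G)
              || has (fun Y => oR (add G Y)) (left_options X).
Proof.
case: G => // l ls r rs _; case: X => // l' ls' r' rs' _.
by rewrite /= has_cat /= !has_map !orbA.
Qed.

Lemma oR_add G X : ~~ terminating G -> ~~ terminating X ->
  oR (add G X) = all (fun W => oL (add W X)) (right_options G)
              && all (fun Y => oL (add G Y)) (right_options X).
Proof.
case: G => // l ls r rs _; case: X => // l' ls' r' rs' _.
have noL s : ~~ has (fun x => ~~ oL x) s = all oL s.
  by rewrite -all_predC; apply: eq_all => x /=; rewrite negbK.
by rewrite /= negb_or negbK noL all_cat /= !all_map -!andbA.
Qed.

Lemma formal_birthday_option G W :
  W \in left_options G ++ right_options G ->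
  formal_birthday W < formal_birthday G.
Proof.
have foldr_ge (d x : form) s : x \in d :: s -> formal_birthday x <=
    foldr (fun y => Num.max (formal_birthday y)) (formal_birthday d) s.
  elim: s => [|y s IHs]; first by rewrite inE => /eqP->.
  rewrite !inE orbCA le_max => /orP[/eqP->|]; first by rewrite lexx.
  by move=> xs; rewrite IHs ?orbT// inE.
case: G => // l ls r rs; rewrite mem_cat.
rewrite [formal_birthday (Game _ _ _ _)]/= addrC ltzD1 le_max.
by case/orP => /foldr_ge ->; rewrite ?orbT.
Qed.

(** Options also sit inside lists, so the induction runs on a natural number bounding the formal
    birthday. In the base case [G] has formal birthday -1 and an option would lie below -1. *)
Lemma form_option_ind (P : form -> Prop) :
  (forall G, (forall W, W \in left_options G ++ right_options G -> P W) ->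
     P G) ->
  forall G, P G.
Proof.
move=> step G.
have [m] : exists m : nat, formal_birthday G < m%:Z.
  by exists `|formal_birthday G|.+1%N; lia.
elim: m G => [|m IHm] G ltGm; apply: step => W /formal_birthday_option.
  by have := formal_birthday_ge W; lia.
by move=> ltWG; apply: IHm; lia.
Qed.

(** * Comparing games through their options *)

Lemma gegP G H : geg G H <-> forall X, ~~ terminating X ->
  (oL (add H X) -> oL (add G X)) /\ (oR (add H X) -> oR (add G X)).
Proof.
have leE U V :
    reflect ((oL U -> oL V) /\ (oR U -> oR V)) (outcome U <= outcome V)%O.
  have le_imply (a b : bool) : (a <= b)%O = (a ==> b) by case: a; case: b.
  rewrite leEprod /= !le_imply.
  by apply: (iffP andP) => -[? ?]; split; exact/implyP.
by split=> GH X nX; apply/leE; apply: GH.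
Qed.

(** Induction on [X]. A winning first move of Left on [G + X] is made in [G], where the first
    hypothesis answers it on [H + X], or in [X], where the induction hypothesis does. If Left wins
    [G + X] moving second, a move of Right on [H + X] is met by the second hypothesis or by
    induction. *)
Lemma geg_options G H : ~~ terminating G -> ~~ terminating H ->
  (forall W X, W \in left_options G -> ~~ terminating X ->
     oR (add W X) -> oL (add H X)) ->
  (forall W X, W \in right_options H -> ~~ terminating X ->
     oR (add G X) -> oL (add W X)) ->
  geg H G.
Proof.
move=> nG nH GL HR; apply/gegP; elim/form_option_ind => X IH nX.
have {}IH Y : Y \in left_options X ++ right_options X ->
    (oL (add G Y) -> oL (add H Y)) /\ (oR (add G Y) -> oR (add H Y)).
  (* Once [X] has moved to a terminating [Y], both sums are [Y] itself. *)
  move=> YX; case: (boolP (terminating Y)) => [tY|]; last exact: IH.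
  by rewrite !add_terminatingr.
split=> [|GX].
  rewrite oL_add// => /orP[/hasP[W WG WX]|/hasP[Y YX GY]]; first exact: GL WX.
  rewrite oL_add//; apply/orP; right; apply/hasP; exists Y => //.
  by apply: (IH _ _).2 GY; rewrite mem_cat YX.
rewrite oR_add//; apply/andP; split; apply/allP => W WX; first exact: HR GX.
apply: (IH _ _).1; first by rewrite mem_cat WX orbT.
by move: GX; rewrite oR_add// => /andP[_ /allP]; exact.
Qed.

Lemma oL_add_right_option G W X : ~~ terminating G -> ~~ terminating X ->
  W \in right_options G -> oR (add G X) -> oL (add W X).
Proof. by move=> nG nX WG; rewrite oR_add// => /andP[/allP + _]; exact. Qed.

Lemma oL_add_left_option G W X : ~~ terminating G -> ~~ terminating X ->
  W \in left_options G -> oR (add W X) -> oL (add G X).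
Proof.
by move=> nG nX WG WX; rewrite oL_add//; apply/orP; left; apply/hasP; exists W.
Qed.

Lemma eqg_outcome G H X : cls G = cls H -> ~~ terminating X ->
  oL (add G X) = oL (add H X) /\ oR (add G X) = oR (add H X).
Proof. by move=> /clsP GH /GH[]. Qed.

Lemma eq_cls G H : geg G H -> geg H G -> cls G = cls H.
Proof. by move=> GH HG; apply/le_anti/andP; split; apply/le_cls. Qed.

(** This makes the game { A | B } independent of the representatives of its options, as [is_game_of]
    demands. *)
Lemma eq_cls_options G H : ~~ terminating G -> ~~ terminating H ->
  left_set G = left_set H -> right_set G = right_set H -> cls G = cls H.
Proof.
have geg_sub A B : ~~ terminating A -> ~~ terminating B ->
    left_set A `<=` left_set B -> right_set B `<=` right_set A -> geg B A.
  move=> nA nB sL sR; apply: geg_options => // W X WI nX.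
    have [W' W'B WW'] : left_set B (cls W) by apply: sL; exists W.
    have [_ <-] := eqg_outcome WW' nX; exact: oL_add_left_option.
  have [W' W'A WW'] : right_set A (cls W) by apply: sR; exists W.
  have [<- _] := eqg_outcome WW' nX; exact: oL_add_right_option.
by move=> nG nH eqL eqR; apply: eq_cls; apply: geg_sub; rewrite ?eqL ?eqR.
Qed.

Lemma cls_infty G : ~~ terminating G -> cls G <> infty.
Proof.
(* In this test game Right, moving first, wins at once by moving to [Minf], whereas [Inf] absorbs
   it. *)
move=> nG /(@eqg_outcome _ _ (Game Minf [::] Minf [::]))[]// _.
by rewrite oR_add//= add_terminatingr// andbF.
Qed.

Lemma cls_minfty G : ~~ terminating G -> cls G <> minfty.
Proof.
move=> nG /(@eqg_outcome _ _ (Game Inf [::] Inf [::]))[]//.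
by rewrite oL_add//= add_terminatingr// orbT.
Qed.

(** * Birthdays, and forms whose options are born before [n] *)

Lemma birthday_ge x : -1 <= birthday x.
Proof. by have [[G _ <-] _] := birthdayP x; exact: formal_birthday_ge. Qed.

Lemma birthday_infty : birthday infty = -1.
Proof. by apply/le_anti; rewrite birthday_ge (proj2 (birthdayP infty) Inf). Qed.

Lemma birthday_minfty : birthday minfty = -1.
Proof. by apply/le_anti; rewrite birthday_ge (proj2 (birthdayP minfty) Minf). Qed.

Lemma terminating_or (x : game) :
  [\/ x = infty, x = minfty | exists2 G, ~~ terminating G & cls G = x].
Proof.
have := reprK x; case: (repr x) => [<-|<-|l ls r rs <-].
- exact: Or31.
- exact: Or32.
- by apply: Or33; exists (Game l ls r rs).
Qed.

(** Take a form of least formal birthday: its options have smaller formal birthday, hence smaller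
    birthday. It is not terminating, since no other form equals [Inf] or [Minf]. *)
Lemma options_before_exists n G : ~~ terminating G -> birthday (cls G) <= n ->
  exists l ls r rs, let H := Game l ls r rs in
    cls H = cls G /\ options_before n H.
Proof.
move=> nG Gn; have [[H HG bH] _] := birthdayP (cls G).
case: H HG bH => [/esym/cls_infty|/esym/cls_minfty|l ls r rs HG bH];
  rewrite ?nG //; try by move=> /(_ isT).
exists l, ls, r, rs; split=> // W /formal_birthday_option WH.
have [_ /(_ W erefl) bW] := birthdayP (cls W).
by rewrite (le_lt_trans bW)// (lt_le_trans WH)// bH.
Qed.

(** It lets [infty] and [minfty], of birthday -1, count as options born before [n]. *)
Lemma birthday_gt n G : ~~ terminating G -> birthday (cls G) <= n -> -1 < n.
Proof.
move=> nG /(options_before_exists nG)[l [ls [r [rs [_ /(_ l)]]]]].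
rewrite inE eqxx => /(_ isT); exact: le_lt_trans (birthday_ge _).
Qed.

(** * Floors and ceilings through winning conditions *)

Lemma lfloorP n G W : ~~ terminating G -> birthday (cls G) <= n ->
  lfloor n (cls G) (cls W) <-> birthday (cls W) < n /\
    (forall X, ~~ terminating X -> oR (add W X) -> oL (add G X)).
Proof.
move=> nG Gn; split=> [[H [nH HG Hn [W' W'H WW']]]|[Wn WG]].
  split=> [|X nX]; first by rewrite -WW'; apply: Hn; rewrite mem_cat W'H.
  have [<- _] := eqg_outcome HG nX; have [_ <-] := eqg_outcome WW' nX.
  exact: oL_add_left_option.
have [l [ls [r [rs [HG Hn]]]]] := options_before_exists nG Gn.
exists (Game W (l :: ls) r rs); split=> //.
(* Only one of the four conditions concerns the added option [W], and there it is exactly [WG]; the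
   others hold because the remaining options are shared. *)
- rewrite -HG; apply: eq_cls; apply: geg_options => // V X VI nX.
  + by apply: oL_add_left_option => //; rewrite inE VI orbT.
  + exact: oL_add_right_option.
  + move: VI; rewrite inE => /predU1P[->|VH]; last exact: oL_add_left_option.
    by have [-> _] := eqg_outcome HG nX; exact: WG.
  + exact: oL_add_right_option.
- by move=> V; rewrite inE => /predU1P[->//|]; exact: Hn.
- by exists W => //=; rewrite inE eqxx.
Qed.

Lemma lceilP n G W : ~~ terminating G -> birthday (cls G) <= n ->
  lceil n (cls G) (cls W) <-> birthday (cls W) < n /\
    (forall X, ~~ terminating X -> oR (add G X) -> oL (add W X)).
Proof.
move=> nG Gn; split=> [[H [nH HG Hn [W' W'H WW']]]|[Wn WG]].
  split=> [|X nX]; first by rewrite -WW'; apply: Hn; rewrite mem_cat W'H orbT.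
  have [_ <-] := eqg_outcome HG nX; have [<- _] := eqg_outcome WW' nX.
  exact: oL_add_right_option.
have [l [ls [r [rs [HG Hn]]]]] := options_before_exists nG Gn.
exists (Game l ls W (r :: rs)); split=> //.
- rewrite -HG; apply: eq_cls; apply: geg_options => // V X VI nX.
  + exact: oL_add_left_option.
  + move: VI; rewrite inE => /predU1P[->|VH]; last exact: oL_add_right_option.
    by have [_ ->] := eqg_outcome HG nX; exact: WG.
  + exact: oL_add_left_option.
  + by apply: oL_add_right_option => //; rewrite inE VI orbT.
- move=> V; rewrite mem_cat orbC inE -orbA => /predU1P[->//|].
  by rewrite orbC -mem_cat; exact: Hn.
- by exists W => //=; rewrite inE eqxx.
Qed.

Lemma lfloor_mono n G H : ~~ terminating G -> ~~ terminating H ->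
  birthday (cls G) <= n -> birthday (cls H) <= n ->
  geg H G -> lfloor n (cls G) `<=` lfloor n (cls H).
Proof.
move=> nG nH Gn Hn /gegP HG w; rewrite -[w]reprK => /(lfloorP _ nG Gn)[wn wG].
by apply/lfloorP => //; split=> // X nX wX; apply: (HG _ nX).1; exact: wG.
Qed.

Lemma lceil_anti n G H : ~~ terminating G -> ~~ terminating H ->
  birthday (cls G) <= n -> birthday (cls H) <= n ->
  geg H G -> lceil n (cls H) `<=` lceil n (cls G).
Proof.
move=> nG nH Gn Hn /gegP HG w; rewrite -[w]reprK => /(lceilP _ nH Hn)[wn wH].
by apply/lceilP => //; split=> // X nX GX; apply: wH => //; exact: (HG _ nX).2.
Qed.

Lemma left_set_lfloor n G H : cls H = cls G -> ~~ terminating H ->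
  options_before n H -> left_set H `<=` lfloor n (cls G).
Proof. by move=> HG nH Hn w Hw; exists H. Qed.

Lemma right_set_lceil n G H : cls H = cls G -> ~~ terminating H ->
  options_before n H -> right_set H `<=` lceil n (cls G).
Proof. by move=> HG nH Hn w Hw; exists H. Qed.

(** [H] is replaced by a form whose options are born before [n]. Its Right options lie in the
    ceiling of [H], so they are Right options of [G], while [lfloorP] turns the Left options of [G]
    into wins on [H]. It serves both for the join below an upper bound and for the meet below its
    arguments. *)
Lemma geg_upper n G H : ~~ terminating G -> ~~ terminating H ->
  birthday (cls H) <= n ->
  left_set G `<=` lfloor n (cls H) `|` [set minfty] ->
  lceil n (cls H) `<=` right_set G -> geg H G.
Proof.
move=> nG nH Hn sL sR.
have [l [ls [r [rs [KH Kn]]]]] := options_before_exists nH Hn.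
apply/le_cls; rewrite -KH; apply/le_cls; apply: geg_options => // W X WI nX.
  have [-> _] := eqg_outcome KH nX.
  have [] : (lfloor n (cls H) `|` [set minfty]) (cls W) by apply: sL; exists W.
    by case/lfloorP => // _; exact.
  (* The option [minfty] never gives Left a win, so its condition is vacuous. *)
  by move=> /eqg_outcome/(_ nX)[_ ->]; rewrite add_terminatingl.
have [W' W'G WW'] : right_set G (cls W).
  by apply/sR/(right_set_lceil KH) => //; exists W.
have [<- _] := eqg_outcome WW' nX; exact: oL_add_right_option.
Qed.

Lemma geg_lower n G H : ~~ terminating G -> ~~ terminating H ->
  birthday (cls G) <= n ->
  right_set H `<=` lceil n (cls G) `|` [set infty] ->
  lfloor n (cls G) `<=` left_set H -> geg H G.
Proof.
move=> nG nH Gn sR sL.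
have [l [ls [r [rs [KG Kn]]]]] := options_before_exists nG Gn.
apply/le_cls; rewrite -KG; apply/le_cls; apply: geg_options => // W X WI nX.
  have [W' W'H WW'] : left_set H (cls W).
    by apply/sL/(left_set_lfloor KG) => //; exists W.
  have [_ <-] := eqg_outcome WW' nX; exact: oL_add_left_option.
have [_ ->] := eqg_outcome KG nX.
have [] : (lceil n (cls G) `|` [set infty]) (cls W) by apply: sR; exists W.
  by case/lceilP => // _; exact.
by move=> /eqg_outcome/(_ nX)[-> _]; rewrite (@add_terminatingl Inf).
Qed.

(** * Finiteness, and games with prescribed sets of options *)

Lemma formal_birthday_le n G : ~~ terminating G ->
  (forall W, W \in left_options G ++ right_options G -> formal_birthday W < n) ->
  formal_birthday G <= n.
Proof.
have foldr_lt (d : form) s : (forall x, x \in d :: s -> formal_birthday x < n) ->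
    foldr (fun y => Num.max (formal_birthday y)) (formal_birthday d) s < n.
  elim: s => [|y s IHs] ltn; first by apply: ltn; rewrite inE.
  rewrite /= gt_max ltn ?IHs ?inE ?eqxx ?orbT// => x xs.
  by apply: ltn; move: xs; rewrite !inE => /orP[]->; rewrite ?orbT.
case: G => // l ls r rs _ ltn.
rewrite [formal_birthday _]/= addrC -ltzD1 ltrD2r gt_max.
by rewrite !foldr_lt// => W WI; apply: ltn; rewrite mem_cat WI ?orbT.
Qed.

(** Unlike [repr x], this representative has a formal birthday equal to the birthday of [x], so
    forms built from such options have a controlled formal birthday. *)
Definition min_form (x : game) : form := projT1 (cid2 (proj1 (birthdayP x))).

Lemma cls_min_form x : cls (min_form x) = x.
Proof. by rewrite /min_form; case: cid2. Qed.

Lemma formal_birthday_min_form x : formal_birthday (min_form x) = birthday x.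
Proof. by rewrite /min_form; case: cid2. Qed.

(* Junk value [Inf] when one of the lists is empty. *)
Definition form_of_seqs (l r : seq game) : form :=
  if (map min_form l, map min_form r) is (x :: ls, y :: rs)
  then Game x ls y rs else Inf.

Lemma form_of_seqsP l r : l != [::] -> r != [::] ->
  [/\ ~~ terminating (form_of_seqs l r),
      left_options (form_of_seqs l r) = map min_form l
    & right_options (form_of_seqs l r) = map min_form r].
Proof. by case: l => // x l; case: r. Qed.

(** Subsets of a list become lists by filtering it. The last clause turns bounds on the birthdays of
    the options into bounds on their formal birthdays. *)
Lemma form_of_filterP (s : seq game) (A B : set game) :
  A `<=` [set` s] -> B `<=` [set` s] -> A !=set0 -> B !=set0 ->
  let G := form_of_seqs [seq x <- s | `[< A x >]] [seq x <- s | `[< B x >]] in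
  [/\ ~~ terminating G, left_set G = A, right_set G = B
    & forall W, W \in left_options G ++ right_options G ->
        formal_birthday W = birthday (cls W)].
Proof.
have filter_neq0 (C : set game) :
    C `<=` [set` s] -> C !=set0 -> [seq x <- s | `[< C x >]] != [::].
  move=> Cs [x Cx]; rewrite -has_filter; apply/hasP; exists x; first exact: Cs.
  exact/asboolP.
have cls_map (C : set game) : C `<=` [set` s] ->
    [set cls W | W in [set` map min_form [seq x <- s | `[< C x >]]]] = C.
  move=> Cs; apply/seteqP; split=> [_ [_ /mapP[x + ->] <-]|x Cx].
    by rewrite cls_min_form mem_filter => /andP[/asboolP].
  exists (min_form x); last exact: cls_min_form.
  by apply: map_f; rewrite mem_filter Cs// andbT; apply/asboolP.
move=> As Bs A0 B0 G.
have [nG GL GR] := form_of_seqsP (filter_neq0 _ As A0) (filter_neq0 _ Bs B0).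
split=> //; rewrite /left_set/right_set ?GL ?GR ?cls_map// => W.
rewrite -map_cat => /mapP[x _ ->].
by rewrite cls_min_form formal_birthday_min_form.
Qed.

Lemma left_set_birthday n G : options_before n G ->
  forall x, left_set G x -> birthday x < n.
Proof. by move=> Gn _ [W WG <-]; apply: Gn; rewrite mem_cat WG. Qed.

Lemma right_set_birthday n G : options_before n G ->
  forall x, right_set G x -> birthday x < n.
Proof. by move=> Gn _ [W WG <-]; apply: Gn; rewrite mem_cat WG orbT. Qed.

Lemma left_set_neq0 G : ~~ terminating G -> left_set G !=set0.
Proof. by case: G => // l ls r rs _; exists (cls l), l => //=; exact: mem_head. Qed.

Lemma right_set_neq0 G : ~~ terminating G -> right_set G !=set0.
Proof. by case: G => // l ls r rs _; exists (cls r), r => //=; exact: mem_head. Qed.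

Lemma finite_games n : exists s : seq game, forall x, birthday x < n -> x \in s.
Proof.
(* A larger, natural bound allows induction; below 0 there are only the two terminating games. *)
suff [s sP] : exists s : seq game, forall x, birthday x < `|n|%N%:Z -> x \in s.
  by exists s => x xn; apply: sP; lia.
elim: `|n|%N => [|m [s sP]].
  exists [:: infty; minfty] => x.
  have [->|->|[G nG <-] x0] := terminating_or x; rewrite ?inE ?eqxx ?orbT//.
  by have := @birthday_gt (-1) G nG; rewrite ltxx; lia.
(* A game of birthday at most [m] is determined by two subsets of [s]. Coding these by boolean masks
   gives [f] a finite domain, so [codom f] lists all such games. *)
pose f (p : (size s).-tuple bool * (size s).-tuple bool) :=
  cls (form_of_seqs (mask p.1 s) (mask p.2 s)).
exists [:: infty, minfty & codom f] => x.
have [->|->|[G nG <-] Gm] := terminating_or x; rewrite ?inE ?eqxx ?orbT//.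
have {}Gm : birthday (cls G) <= m%:Z by lia.
have [l [ls [r [rs []]]]] := options_before_exists nG Gm.
set H := Game l ls r rs => HG Hm.
have HL : left_set H `<=` [set` s] by move=> y /(left_set_birthday Hm)/sP.
have HR : right_set H `<=` [set` s] by move=> y /(right_set_birthday Hm)/sP.
have [nK KL KR _] :=
  form_of_filterP HL HR (@left_set_neq0 H isT) (@right_set_neq0 H isT).
apply/orP; right; apply/orP; right; apply/codomP.
exists (map_tuple (fun y => `[< left_set H y >]) (in_tuple s),
        map_tuple (fun y => `[< right_set H y >]) (in_tuple s)).
by rewrite /f /= -!filter_mask -HG; apply/esym/eq_cls_options.
Qed.

(** By [finite_games] both sets fit in one list. Options taken as minimal forms have formal birthday
    less than [n], so the form built on them has formal birthday at most [n]. *)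
Lemma exists_game_of n (A B : set game) :
  (forall x, A x -> birthday x < n) -> (forall x, B x -> birthday x < n) ->
  A !=set0 -> B !=set0 ->
  exists G, [/\ ~~ terminating G, left_set G = A, right_set G = B
              & birthday (cls G) <= n].
Proof.
move=> An Bn A0 B0; have [s sP] := finite_games n.
have As : A `<=` [set` s] by move=> x /An/sP.
have Bs : B `<=` [set` s] by move=> x /Bn/sP.
have [] := form_of_filterP As Bs A0 B0; set G := form_of_seqs _ _.
move=> nG GA GB Gmin; exists G; split=> //.
apply: le_trans (proj2 (birthdayP _) G erefl) _.
apply: formal_birthday_le => // W WG; rewrite Gmin//.
move: WG; rewrite mem_cat => /orP[] WG; [apply: An|apply: Bn].
  by rewrite -GA; exists W.
by rewrite -GB; exists W.
Qed.

Lemma is_game_of_cls G : ~~ terminating G ->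
  is_game_of (left_set G) (right_set G) (cls G).
Proof.
by move=> nG; split=> [|H [nH HL HR]]; [exists G|exact: eq_cls_options].
Qed.

(** * Joins and meets *)

Lemma le_infty (x : game) : (x <= infty)%O.
Proof.
by rewrite -[x]reprK; apply/le_cls/gegP => X nX; rewrite (@add_terminatingl Inf).
Qed.

Lemma minfty_le (x : game) : (minfty <= x)%O.
Proof.
by rewrite -[x]reprK; apply/le_cls/gegP => X nX; rewrite (@add_terminatingl Minf).
Qed.

Lemma supremums2P d (T : porderType d) (x y z : T) :
  (x <= z)%O -> (y <= z)%O ->
  (forall k, (x <= k)%O -> (y <= k)%O -> (z <= k)%O) ->
  supremums [set x; y] z.
Proof.
move=> xz yz zmin; split=> [_ [->|->]//|k ubk].
by apply: zmin; apply: ubk; [left|right].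
Qed.

Lemma infimums2P d (T : porderType d) (x y z : T) :
  (z <= x)%O -> (z <= y)%O ->
  (forall k, (k <= x)%O -> (k <= y)%O -> (k <= z)%O) ->
  infimums [set x; y] z.
Proof.
move=> zx zy zmax; split=> [_ [->|->]//|k lbk].
by apply: zmax; apply: lbk; [left|right].
Qed.

Lemma lfloor_birthday n x w : lfloor n x w -> birthday w < n.
Proof. by case=> G [_ _ /left_set_birthday]; exact. Qed.

Lemma lceil_birthday n x w : lceil n x w -> birthday w < n.
Proof. by case=> G [_ _ /right_set_birthday]; exact. Qed.

Lemma lfloor_neq0 n G : ~~ terminating G -> birthday (cls G) <= n ->
  lfloor n (cls G) !=set0.
Proof.
move=> nG /(options_before_exists nG)[l [ls [r [rs [HG Hn]]]]].
have [w wH] := @left_set_neq0 (Game l ls r rs) isT.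
by exists w; apply: left_set_lfloor HG _ Hn _ wH.
Qed.

Lemma lceil_neq0 n G : ~~ terminating G -> birthday (cls G) <= n ->
  lceil n (cls G) !=set0.
Proof.
move=> nG /(options_before_exists nG)[l [ls [r [rs [HG Hn]]]]].
have [w wH] := @right_set_neq0 (Game l ls r rs) isT.
by exists w; apply: right_set_lceil HG _ Hn _ wH.
Qed.

Lemma join_exists n (x y : games n) : exists z : games n,
  supremums [set x; y] z /\
  (val x <> infty -> val x <> minfty -> val y <> infty -> val y <> minfty ->
   is_game_of (lfloor n (val x) `|` lfloor n (val y))
              ((lceil n (val x) `&` lceil n (val y)) `|` [set infty]) (val z)).
Proof.
(* As [infty] is the top and [minfty] the bottom, if either argument is terminating then the join is
   one of the two arguments. *)
have [xI|xM|[G nG xG]] := terminating_or (val x).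
- exists x; split=> //; apply: supremums2P => //.
  by rewrite leEsub xI; exact: le_infty.
- exists y; split=> //; apply: supremums2P => //.
  by rewrite leEsub xM; exact: minfty_le.
have [yI|yM|[H nH yH]] := terminating_or (val y).
- exists y; split=> //; apply: supremums2P => //.
  by rewrite leEsub yI; exact: le_infty.
- exists x; split=> //; apply: supremums2P => //.
  by rewrite leEsub yM; exact: minfty_le.
have Gn : birthday (cls G) <= n by rewrite xG; exact: valP x.
have Hn : birthday (cls H) <= n by rewrite yH; exact: valP y.
have [| | | |J [nJ JL JR Jn]] := @exists_game_of n
    (lfloor n (cls G) `|` lfloor n (cls H))
    ((lceil n (cls G) `&` lceil n (cls H)) `|` [set infty]).
- by move=> w [] /lfloor_birthday.
- move=> w [[/lceil_birthday//]|->]; rewrite birthday_infty.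
  exact: birthday_gt nG Gn.
- by have [w wG] := lfloor_neq0 nG Gn; exists w; left.
- by exists infty; right.
exists (Sub (cls J) Jn : games n); split=> [|_ _ _ _]; last first.
  by rewrite SubK -xG -yH -JL -JR; exact: is_game_of_cls.
apply: supremums2P => [||k]; rewrite !leEsub SubK.
- rewrite -xG; apply/le_cls/(geg_lower nG nJ Gn); rewrite ?JL ?JR.
    by apply: setSU => w [].
  exact: subsetUl.
- rewrite -yH; apply/le_cls/(geg_lower nH nJ Hn); rewrite ?JL ?JR.
    by apply: setSU => w [].
  exact: subsetUr.
have [->|kM xk|[K nK kK]] := terminating_or (val k).
- by move=> *; exact: le_infty.
(* An upper bound equal to [minfty] would force the non-terminating [G] to be [minfty]. *)
- have /(cls_minfty nG)[] : cls G = minfty.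
  by apply/le_anti; rewrite minfty_le xG -kM xk.
have Kn : birthday (cls K) <= n by rewrite kK; exact: valP k.
rewrite -xG -yH -kK => /le_cls GK /le_cls HK.
(* The floor of [K] contains both floors, and its ceiling lies in both ceilings, by monotonicity. *)
apply/le_cls/(geg_upper nJ nK Kn); rewrite ?JL ?JR.
  move=> w [] wGH; left; first exact: lfloor_mono GK _ wGH.
  exact: lfloor_mono HK _ wGH.
move=> w wK; left; split; first exact: lceil_anti GK _ wK.
exact: lceil_anti HK _ wK.
Qed.

Lemma meet_exists n (x y : games n) : exists z : games n,
  infimums [set x; y] z /\
  (val x <> infty -> val x <> minfty -> val y <> infty -> val y <> minfty ->
   is_game_of ((lfloor n (val x) `&` lfloor n (val y)) `|` [set minfty])
              (lceil n (val x) `|` lceil n (val y)) (val z)).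
Proof.
have [xI|xM|[G nG xG]] := terminating_or (val x).
- exists y; split=> //; apply: infimums2P => //.
  by rewrite leEsub xI; exact: le_infty.
- exists x; split=> //; apply: infimums2P => //.
  by rewrite leEsub xM; exact: minfty_le.
have [yI|yM|[H nH yH]] := terminating_or (val y).
- exists x; split=> //; apply: infimums2P => //.
  by rewrite leEsub yI; exact: le_infty.
- exists y; split=> //; apply: infimums2P => //.
  by rewrite leEsub yM; exact: minfty_le.
have Gn : birthday (cls G) <= n by rewrite xG; exact: valP x.
have Hn : birthday (cls H) <= n by rewrite yH; exact: valP y.
have [| | | |M [nM ML MR Mn]] := @exists_game_of n
    ((lfloor n (cls G) `&` lfloor n (cls H)) `|` [set minfty])
    (lceil n (cls G) `|` lceil n (cls H)).
- move=> w [[/lfloor_birthday//]|->]; rewrite birthday_minfty.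
  exact: birthday_gt nG Gn.
- by move=> w [] /lceil_birthday.
- by exists minfty; right.
- by have [w wG] := lceil_neq0 nG Gn; exists w; left.
exists (Sub (cls M) Mn : games n); split=> [|_ _ _ _]; last first.
  by rewrite SubK -xG -yH -ML -MR; exact: is_game_of_cls.
apply: infimums2P => [||k]; rewrite !leEsub SubK.
- rewrite -xG; apply/le_cls/(geg_upper nM nG Gn); rewrite ?ML ?MR.
    by apply: setSU => w [].
  exact: subsetUl.
- rewrite -yH; apply/le_cls/(geg_upper nM nH Hn); rewrite ?ML ?MR.
    by apply: setSU => w [].
  exact: subsetUr.
have [kI kx|->|[K nK kK]] := terminating_or (val k).
- have /(cls_infty nG)[] : cls G = infty.
  by apply/le_anti; rewrite le_infty xG -kI kx.
- by move=> *; exact: minfty_le.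
have Kn : birthday (cls K) <= n by rewrite kK; exact: valP k.
rewrite -xG -yH -kK => /le_cls KG /le_cls KH.
(* Dually, for a lower bound [K] the ceiling contains both ceilings and the floor lies in both
   floors. *)
apply/le_cls/(geg_lower nK nM Kn); rewrite ?ML ?MR.
  move=> w [] wGH; left; first exact: lceil_anti KG _ wGH.
  exact: lceil_anti KH _ wGH.
move=> w wK; left; split; first exact: lfloor_mono KG _ wK.
exact: lfloor_mono KH _ wK.
Qed.

Theorem theorem66 (n : int) (hn : - 1 <= n) :
  exists join meet : games n -> games n -> games n,
    [/\ forall G H : games n, supremums [set G; H] (join G H),
        forall G H : games n, infimums [set G; H] (meet G H)
      & forall G H : games n,
          val G <> infty -> val G <> minfty ->
          val H <> infty -> val H <> minfty ->
          is_game_of (lfloor n (val G) `|` lfloor n (val H))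
                     ((lceil n (val G) `&` lceil n (val H)) `|` [set infty])
                     (val (join G H)) /\
          is_game_of ((lfloor n (val G) `&` lfloor n (val H)) `|` [set minfty])
                     (lceil n (val G) `|` lceil n (val H))
                     (val (meet G H))].
Proof.
have [join joinP] := choice (fun p : games n * games n => join_exists p.1 p.2).
have [meet meetP] := choice (fun p : games n * games n => meet_exists p.1 p.2).
exists (fun G H => join (G, H)), (fun G H => meet (G, H)); split=> G H.
- by have [] := joinP (G, H).
- by have [] := meetP (G, H).
move=> GI GM HI HM; split.
  by have [_ +] := joinP (G, H); exact.
by have [_ +] := meetP (G, H); exact.
Qed.
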